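(* Let $H$ be a complex Hilbert space and $\{\mathcal{U}(t)\}_{t\geq 0}$ a strongly continuous semigroup on $H$ with generator $\mathcal{L}$. Let $z\in D(\mathcal{L}^\dagger)$ with $z\neq0$, $\mathcal{P}:=(\cdot,z)(z,z)^{-1}z$, $\mathcal{Q}:=1-\mathcal{P}$. For $x\in H$ let $f(x,\cdot):\mathbb{R}_+\to\mathbb{C}$ be the unique continuous solution of $$f(x,t)=(\mathcal{U}(t)\mathcal{Q}x,\mathcal{Q}\mathcal{L}^\dagger z)(z,z)^{-1}-\int_0^tf(x,t-s)\,(\mathcal{U}(s)z,\mathcal{Q}\mathcal{L}^\dagger z)(z,z)^{-1}\,ds,$$ and define $u(x,t):=\mathcal{P}x+\mathcal{U}(t)\mathcal{Q}x-\int_0^tf(x,t-s)\,\mathcal{U}(s)z\,ds$. Then $\{\mathcal{G}(t):=u(\cdot,t)\}_{t\geq0}$ is a strongly continuous semigroup of bounded linear operators on $H$.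
   Context: The scalar product $(\cdot,\cdot)$ on $H$ is conjugate-linear in its second argument. The generator is $\mathcal{L}x:=\lim_{h\searrow 0}\frac1h[\mathcal{U}(h)x-x]$ on the set $D(\mathcal{L})$ where the limit exists; $\dagger$ denotes the adjoint. Integrals are Bochner integrals. *)

(* Defs.v *)
From HB Require Import structures.
From mathcomp Require Import all_boot all_order all_algebra.
From mathcomp Require Import all_classical all_reals all_analysis.
From mathcomp.real_closed Require Import complex.
Import Order.TTheory GRing.Theory Num.Theory.
Import numFieldNormedType.Exports.

Set Implicit Arguments.
Unset Strict Implicit.
Unset Printing Implicit Defensive.

Local Open Scope ring_scope.
Local Open Scope classical_set_scope.

Definition Cplx (R : realType) : normedModType R[i] := (R[i])^o.

Definition ofR (R : realType) (r : R) : R[i] := (r%:C)%C.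

Definition is_inner_product (R : realType) (H : normedModType R[i])
    (ip : H -> H -> R[i]) : Prop :=
  [/\ forall (a : R[i]) (x y w : H), ip (a *: x + y) w = a * ip x w + ip y w,
      forall x y : H, ip y x = (ip x y)^*
    & forall x : H, ip x x = `|x| ^+ 2].

Definition bdd_Clinear (R : realType) (H : normedModType R[i])
    (A : H -> H) : Prop :=
  (forall (a : R[i]) (x y : H), A (a *: x + y) = a *: A x + A y) /\
  exists M : R[i], forall x : H, `|A x| <= M * `|x|.

Definition C0_semigroup (R : realType) (H : normedModType R[i])
    (U : R -> H -> H) : Prop :=
  [/\ forall t : R, 0 <= t -> bdd_Clinear (U t),
      forall x : H, U 0 x = x,
      forall (s t : R) (x : H), 0 <= s -> 0 <= t -> U (s + t) x = U s (U t x)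
    & forall x : H, {within `[0, +oo[, continuous (fun t : R => U t x)}].

Definition diff_quot (R : realType) (H : normedModType R[i])
    (U : R -> H -> H) (x : H) (h : R) : H :=
  ofR h^-1 *: (U h x - x).

Definition sg_gen_dom (R : realType) (H : normedModType R[i])
    (U : R -> H -> H) (x : H) : Prop :=
  exists v : H, diff_quot U x h @[h --> 0^'+] --> v.

Definition sg_gen (R : realType) (H : normedModType R[i])
    (U : R -> H -> H) (x : H) : H :=
  lim (diff_quot U x h @[h --> 0^'+]).

(** [is_gen_adjoint ip U z w] : z \in D(L^dagger) and L^dagger z = w, i.e.
    (L x, z) = (x, w) for all x \in D(L). (D(L) is dense for a C0-semigroup,
    so w is uniquely determined by z.) *)
Definition is_gen_adjoint (R : realType) (H : normedModType R[i])
    (ip : H -> H -> R[i]) (U : R -> H -> H) (z w : H) : Prop :=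
  forall x : H, sg_gen_dom U x -> ip (sg_gen U x) z = ip x w.

(** Integral over [0,t] of a continuous function g with values in a complex
    normed space, as the limit of the Riemann sums
    (t/n) sum_{k<n} g(k t / n).  For continuous integrands (the only ones
    used below) this coincides with the Bochner integral. *)
Definition bochner0t (R : realType) (V : normedModType R[i])
    (g : R -> V) (t : R) : V :=
  lim ((ofR (t / n%:R) *: \sum_(k < n) g (k%:R * t / n%:R)) @[n --> \oo]).

Definition projP (R : realType) (H : normedModType R[i])
    (ip : H -> H -> R[i]) (z x : H) : H :=
  (ip x z / ip z z) *: z.

Definition projQ (R : realType) (H : normedModType R[i])
    (ip : H -> H -> R[i]) (z x : H) : H :=
  x - projP ip z x.

(* Main.v *)
(** Let [w = Q L^dagger z / (z, z)]. As [w] is orthogonal to [z], the equation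
    for [f] says [f(x, t) = (Y(t), w)], where
    [Y(t) = U(t) Q x - int_0^t f(x, t - s) U(s) z ds]. Splitting the integral
    gives [Y(h + t) = U(h) Y(t) - int_0^h f(x, t + h - s) U(s) z ds]. Together
    with [(U(h) y - y, z) = (int_0^h U(s) y ds, L^dagger z)], which holds for
    all [y] because the integral lies in [D(L)], this shows that [p = (Y, z)]
    has right derivative [kappa p] with [p(0) = 0], so [p = 0] by Gronwall.
    Hence [P u(x, t) = P x] and [Q u(x, t) = Y(t)], and [f(x, t + .)] solves
    the same Volterra equation as [f(u(x, t), .)]; uniqueness for that equation
    yields the semigroup law and linearity. Boundedness follows from an a priori
    bound for the Volterra equation and the uniform boundedness principle, which
    bounds [U] on compact time intervals. *)
Require Import Defs.
From HB Require Import structures.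
From mathcomp Require Import all_boot all_order all_algebra.
From mathcomp Require Import all_classical all_reals all_analysis.
From mathcomp.real_closed Require Import complex.
From mathcomp Require Import ring lra.
Import Order.TTheory GRing.Theory Num.Theory.
Import numFieldNormedType.Exports.
Set Implicit Arguments.
Unset Strict Implicit.
Unset Printing Implicit Defensive.
Local Open Scope ring_scope.
Local Open Scope classical_set_scope.

HB.instance Definition _ (R : realType) :=
  GRing.RMorphism.copy (@ofR R) (real_complex R).

(* The norm of a module over [R[i]] takes its values in [R[i]]; [rnorm] is the
   same norm with values in [R]. *)
Definition rnorm (R : realType) (V : normedZmodType R[i]) (x : V) : R :=
  complex.Re `|x|.

Section RealNorm.
Context {R : realType}.

Lemma ler_ofR (r s : R) : (ofR r <= ofR s) = (r <= s).
Proof. exact: lecR. Qed.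

Lemma ltr_ofR (r s : R) : (ofR r < ofR s) = (r < s).
Proof. exact: ltcR. Qed.

Lemma ofR_gt0 (r : R) : (0 < ofR r) = (0 < r).
Proof. exact: (ltcR 0 r). Qed.

Lemma gt0_ofR (e : R[i]) : 0 < e -> exists2 r : R, 0 < r & e = ofR r.
Proof.
move=> e0; have /complex_realP[r er] := gtr0_real e0.
by exists r => //; rewrite -ofR_gt0 /ofR -er.
Qed.

Section NormedZmodule.
Context {V : normedZmodType R[i]}.
Implicit Types x y : V.

Lemma normE x : `|x| = ofR (rnorm x).
Proof. by rewrite /rnorm /ofR RRe_real // normr_real. Qed.

Lemma rnorm_ge0 x : 0 <= rnorm x.
Proof. by rewrite -ler_ofR -normE rmorph0. Qed.

Lemma rnorm0 : rnorm (0 : V) = 0.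
Proof. by rewrite /rnorm normr0. Qed.

Lemma rnorm_eq0 x : rnorm x = 0 -> x = 0.
Proof. by move=> x0; apply/normr0_eq0; rewrite normE x0 rmorph0. Qed.

Lemma rnormN x : rnorm (- x) = rnorm x.
Proof. by rewrite /rnorm normrN. Qed.

Lemma rnorm_distrC x y : rnorm (x - y) = rnorm (y - x).
Proof. by rewrite /rnorm distrC. Qed.

Lemma ler_rnormD x y : rnorm (x + y) <= rnorm x + rnorm y.
Proof. by rewrite -ler_ofR rmorphD /= -!normE ler_normD. Qed.

Lemma ler_rnormB x y : rnorm (x - y) <= rnorm x + rnorm y.
Proof. by rewrite -[rnorm y]rnormN ler_rnormD. Qed.

Lemma ler_rnorm_sum (I : Type) (r : seq I) (P : pred I) (F : I -> V) :
  rnorm (\sum_(i <- r | P i) F i) <= \sum_(i <- r | P i) rnorm (F i).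
Proof.
elim/big_ind2 : _ => [|x r1 y r2 xr1 yr2|//]; first by rewrite rnorm0.
exact: le_trans (ler_rnormD _ _) (lerD xr1 yr2).
Qed.

End NormedZmodule.

Lemma rnormM (a b : R[i]) : rnorm (a * b) = rnorm a * rnorm b.
Proof. by apply: (fmorph_inj (@ofR R)); rewrite rmorphM /= -!normE normrM. Qed.

Lemma rnorm_ofR (r : R) : rnorm (ofR r) = `|r|.
Proof. by rewrite /rnorm normc_def /= expr0n addr0 sqrtr_sqr. Qed.

Section NormedModule.
Context {V : normedModType R[i]}.
Implicit Types x y : V.

Lemma rnormZ (a : R[i]) x : rnorm (a *: x) = rnorm a * rnorm x.
Proof. by apply: (fmorph_inj (@ofR R)); rewrite rmorphM /= -!normE normrZ. Qed.

Lemma cvg_rnormP {T : Type} {F : set_system T} {FF : Filter F} (f : T -> V)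
    (l : V) :
  f x @[x --> F] --> l <->
  forall e : R, 0 < e -> \forall x \near F, rnorm (f x - l) < e.
Proof.
rewrite cvgrPdist_lt; split=> [fl e e0|fl e /gt0_ofR[r r0 ->{e}]].
  have := fl (ofR e); rewrite ofR_gt0 => /(_ e0).
  by apply: filterS => x; rewrite normE ltr_ofR rnorm_distrC.
by apply: filterS (fl r r0) => x; rewrite normE ltr_ofR rnorm_distrC.
Qed.

Lemma continuous_rnorm : continuous (@rnorm R V).
Proof.
move=> x; apply/cvgrPdist_lt => e e0.
have /cvg_rnormP/(_ e e0) : (y : V) @[y --> x] --> x by exact: cvg_id.
apply: filterS => y; apply: le_lt_trans.
rewrite -ler_ofR -normE -rnorm_ofR -normE rmorphB /= -!normE.
by rewrite [leRHS]distrC ler_dist_dist.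
Qed.

Lemma cvg_rnorm_le {T : Type} {F : set_system T} {FF : ProperFilter F}
    (f : T -> V) (l : V) (M : R) :
  f x @[x --> F] --> l -> (\forall x \near F, rnorm (f x) <= M) -> rnorm l <= M.
Proof.
by move=> /(cvg_comp _ _)/(_ (@continuous_rnorm l)); exact: cvgr_to_le.
Qed.

End NormedModule.
End RealNorm.

(* The real Banach space underlying a complex one: the library proves the
   Banach-Steinhaus theorem over real scalars only. *)
Definition realification (R : realType) (V : normedModType R[i]) : Type := V.

Section Realification.
Context {R : realType}.

Section Module.
Context {V : normedModType R[i]}.
Local Notation VR := (realification V).

HB.instance Definition _ := GRing.Zmodule.on VR.

Let scale (r : R) (x : VR) : VR := ofR r *: (x : V).

Let scaleA r s x : scale r (scale s x) = scale (r * s) x.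
Proof. by rewrite /scale scalerA rmorphM. Qed.

Let scale1 : left_id 1 scale.
Proof. by move=> x; rewrite /scale rmorph1 scale1r. Qed.

Let scaleDr : right_distributive scale +%R.
Proof. by move=> r x y; exact: scalerDr. Qed.

Let scaleDl x : {morph scale^~ x : r s / r + s}.
Proof. by move=> r s; rewrite /scale rmorphD scalerDl. Qed.

HB.instance Definition _ :=
  GRing.Zmodule_isLmodule.Build R VR scaleA scale1 scaleDr scaleDl.

Let rnorm_scale (r : R) (x : VR) : rnorm (r *: x : V) = `|r| * rnorm (x : V).
Proof. by rewrite rnormZ rnorm_ofR. Qed.

HB.instance Definition _ := @Lmodule_isNormed.Build R VR (@rnorm R V)
  (@ler_rnormD R V) rnorm_scale (@rnorm_eq0 R V).

End Module.

Section Complete.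
Context {V : completeNormedModType R[i]}.
Local Notation VR := (realification V).

Let complete (F : set_system VR) : ProperFilter F -> cauchy F -> cvg F.
Proof.
move=> FF /cauchyP Fc.
have /cauchy_cvgP/cvg_ex[l Fl] : cauchy (F : set_system V).
  apply: cauchy_exP => e /gt0_ofR[r r0 ->{e}]; have [x Fx] := Fc r r0.
  exists x; apply: filterS Fx => y; rewrite -!ball_normE /ball_ /=.
  by rewrite normE ltr_ofR.
apply/cvg_ex; exists l; apply/cvgrPdist_lt => e e0.
move/cvgrPdist_lt : Fl => /(_ (ofR e)); rewrite ofR_gt0 => /(_ e0).
by apply: filterS => y /=; rewrite normE ltr_ofR.
Qed.

HB.instance Definition _ := Uniform_isComplete.Build VR complete.
End Complete.
End Realification.

Section BoundedLinear.
Context {R : realType}.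

Lemma continuous_linear_bound {V W : normedModType R[i]} (A : {linear V -> W}) :
  continuous A -> exists2 M : R, 0 <= M & forall x, rnorm (A x) <= M * rnorm x.
Proof.
move=> /(_ 0)/(continuous_linear_bounded 0)/linear_boundedP.
move=> /pinfty_ex_gt0[M /gt0_ofR[m m0 ->{M}] AM].
exists m => [|x]; first exact: ltW.
by have := AM x; rewrite !normE -rmorphM ler_ofR.
Qed.

Lemma linear_bound_continuous {V W : normedModType R[i]} (A : {linear V -> W})
    (M : R) :
  (forall x, rnorm (A x) <= M * rnorm x) -> continuous A.
Proof.
move=> AM; apply: bounded_linear_continuous; apply/bounded_funP => r.
exists (ofR `|M| * r) => x xr; apply: le_trans (ler_wpM2l _ xr).
  rewrite !normE -rmorphM ler_ofR; apply: le_trans (AM x) _.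
  by rewrite ler_wpM2r ?rnorm_ge0 ?ler_norm.
by rewrite -[0](rmorph0 (@ofR R)) ler_ofR.
Qed.

Lemma linear_unit_ball_bound {V W : normedModType R[i]} (A : {linear V -> W})
    (M : R) :
  (forall x, rnorm x <= 1 -> rnorm (A x) <= M) ->
  forall x, rnorm (A x) <= M * rnorm x.
Proof.
move=> AM x; have [/rnorm_eq0->|x0] := eqVneq (rnorm x) 0.
  by rewrite linear0 !rnorm0 mulr0.
have x_gt0 : 0 < rnorm x by rewrite lt_def x0 rnorm_ge0.
have unit_norm : `|(rnorm x)^-1| * rnorm x = 1.
  by rewrite gtr0_norm ?invr_gt0 // mulVf.
have := AM (ofR (rnorm x)^-1 *: x); rewrite linearZ !rnormZ rnorm_ofR.
rewrite unit_norm gtr0_norm ?invr_gt0 // => /(_ (lexx 1)).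
by rewrite mulrC ler_pdivrMr.
Qed.

Lemma uniform_boundedness {V : completeNormedModType R[i]}
    {W : normedModType R[i]} {I : Type} (A : I -> {linear V -> W}) :
  (forall i, continuous (A i)) ->
  (forall x, exists M : R, forall i, rnorm (A i x) <= M) ->
  exists2 M : R, 0 <= M & forall i x, rnorm (A i x) <= M * rnorm x.
Proof.
move=> cA ptA.
have [f [i _ <-]|x|M AM] := @Banach_Steinhauss R (realification V)
    (realification W) (range (fun i => A i : V -> W)) _ _ 1.
- split=> [r|a x y]; last exact: (linearP (A i) (ofR a) x y).
  have [M M0 AM] := continuous_linear_bound (cA i); exists (M * r) => x xr.
  exact: le_trans (AM x) (ler_wpM2l M0 xr).
- by have [M AM] := ptA x; exists M => f [i _ <-]; exact: AM.
exists `|M| => // i; apply: linear_unit_ball_bound => x x1.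
by apply: le_trans (ler_norm M); apply: AM (x1) => //; exists i.
Qed.

End BoundedLinear.

Section CompactSegment.
Context {R : realType} {V : normedModType R[i]}.

Lemma near_uniform_segment {T : topologicalType} (K : T -> R -> V) (u : T)
    (a b e : R) :
  continuous (fun p => K p.1 p.2) -> 0 < e ->
  \forall u' \near u, forall c, a <= c <= b -> rnorm (K u' c - K u c) < e.
Proof.
move=> cK e0; have /compact_near_coveringP := @segment_compact R a b.
move=> /(_ _ (nbhs u) (fun u' c => rnorm (K u' c - K u c) < e)) covering.
apply: filterS (covering _ _) => [u' h c /andP[ac cb]|c _].
  by apply: h; rewrite /= in_itv /= ac.
have e2 : 0 < e / 2 by rewrite divr_gt0.
have /cvg_rnormP/(_ _ e2)[[A B] [/= Au Bc] AB] := cK (u, c).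
exists (B, A) => // -[c' u'] [/= Bc' Au'].
have Ku'c'_near := AB (u', c') (conj Au' Bc').
have Kuc'_near := AB (u, c') (conj (nbhs_singleton Au) Bc').
have -> : K u' c' - K u c' = (K u' c' - K u c) - (K u c' - K u c).
  by rewrite opprB addrA subrK.
apply: le_lt_trans (ler_rnormB _ _) _.
by rewrite [e]splitr ltrD.
Qed.

Lemma rnorm_bounded_segment (g : R -> V) (a b : R) : continuous g ->
  exists2 M, 0 <= M & forall s, a <= s <= b -> rnorm (g s) <= M.
Proof.
move=> cg; have [ab|ba] := leP a b; last first.
  exists 0 => // s /andP[a_s s_b].
  by have := le_trans a_s s_b; rewrite leNgt ba.
have [|c _ max_c] := @EVT_max _ (fun s => rnorm (g s)) a b ab.
  apply: continuous_subspaceT => x.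
  exact: cvg_comp (cg x) (@continuous_rnorm R V (g x)).
exists (rnorm (g c)) => [|s s_ab]; first exact: rnorm_ge0.
by apply: max_c; rewrite in_itv.
Qed.

End CompactSegment.

Section RiemannSums.
Context {R : realType} {V : normedModType R[i]}.
Implicit Types (g : R -> V) (t h M : R).

Definition riemann_sum g t n : V :=
  ofR (t / n%:R) *: \sum_(k < n) g (k%:R * t / n%:R).

Lemma sample_itv t n k : 0 <= t -> (k < n)%N -> 0 <= k%:R * t / n%:R <= t.
Proof.
move=> t0 kn; have n0 : 0 < n%:R :> R by rewrite ltr0n (leq_ltn_trans _ kn).
rewrite divr_ge0 ?mulr_ge0 //= ler_pdivrMr // mulrC.
by rewrite ler_wpM2l // ler_nat ltnW.
Qed.

Lemma eq_riemann_sum g1 g2 t n : 0 <= t ->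
  (forall s, 0 <= s <= t -> g1 s = g2 s) ->
  riemann_sum g1 t n = riemann_sum g2 t n.
Proof.
move=> t0 g12; congr (_ *: _); apply: eq_bigr => k _.
by apply: g12; exact: sample_itv.
Qed.

Lemma rnorm_riemann_sum_le g t M n : 0 <= t -> 0 <= M ->
  (forall s, 0 <= s <= t -> rnorm (g s) <= M) ->
  rnorm (riemann_sum g t n) <= t * M.
Proof.
move=> t0 M0 gM; rewrite rnormZ rnorm_ofR ger0_norm ?divr_ge0 //.
apply: (@le_trans _ _ (t / n%:R * \sum_(k < n) M)).
  rewrite ler_wpM2l ?divr_ge0 //.
  apply: le_trans (ler_rnorm_sum _ _ _) _; apply: ler_sum => k _.
  by apply: gM; exact: sample_itv.
rewrite sumr_const card_ord -[M *+ n]mulr_natl mulrA ler_wpM2r //.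
by case: n => [|n]; rewrite ?mulr0 // divfK.
Qed.

Lemma riemann_sum_lincomb (a : R[i]) g1 g2 t n :
  riemann_sum (fun s => a *: g1 s + g2 s) t n =
  a *: riemann_sum g1 t n + riemann_sum g2 t n.
Proof.
by rewrite /riemann_sum big_split /= -scaler_sumr scalerDr !scalerA mulrC.
Qed.

Lemma riemann_sum_cst (v : V) t n : (0 < n)%N ->
  riemann_sum (fun=> v) t n = ofR t *: v.
Proof.
move=> n0; rewrite /riemann_sum sumr_const card_ord -[v *+ _]scaler_nat scalerA.
by rewrite -(rmorph_nat (@ofR R)) -rmorphM /= divfK // pnatr_eq0 -lt0n.
Qed.

Lemma riemann_sum_scale g t n :
  riemann_sum g t n = ofR t *: riemann_sum (fun c => g (c * t)) 1 n.
Proof.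
rewrite /riemann_sum scalerA -rmorphM mul1r; congr (_ *: _).
by apply: eq_bigr => k _; rewrite mulr1 mulrAC.
Qed.

Lemma riemann_sum_blocks g h p n :
  riemann_sum g (p%:R * h) (p * n) =
  \sum_(j < p) riemann_sum (fun u => g (j%:R * h + u)) h n.
Proof.
case: (posnP n) => [->|n0].
  rewrite muln0 /riemann_sum big_ord0 scaler0 big1 // => j _.
  by rewrite big_ord0 scaler0.
case: (posnP p) => [->|p0].
  by rewrite mul0n /riemann_sum !big_ord0 scaler0.
have p_neq0 : p%:R != 0 :> R by rewrite pnatr_eq0 -lt0n.
have n_neq0 : n%:R != 0 :> R by rewrite pnatr_eq0 -lt0n.
rewrite /riemann_sum -scaler_sumr natrM; congr (ofR _ *: _).
  by field; rewrite p_neq0 n_neq0.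
rewrite -(big_mkord xpredT (fun k => g (k%:R * (p%:R * h) / (p%:R * n%:R)))).
rewrite big_nat_mul big_mkord; apply: eq_bigr => j _.
rewrite -{1}[(j * n)%N]add0n big_addn mulSn addnK big_mkord.
apply: eq_bigr => k _; rewrite natrD natrM; congr g.
by field; rewrite p_neq0 n_neq0.
Qed.

Lemma riemann_sum_refine g d e n m : 0 <= e ->
  (forall u, `|u| < d -> forall c, 0 <= c <= 1 ->
    rnorm (g (c + u) - g c) <= e) ->
  (0 < n)%N -> (0 < m)%N -> n%:R^-1 < d ->
  rnorm (riemann_sum g 1 (n * m) - riemann_sum g 1 n) <= e.
Proof.
move=> e0 modulus n0 m0 nd; have n_gt0 : 0 < n%:R :> R by rewrite ltr0n.
have one_block : 1 = n%:R * n%:R^-1 :> R by rewrite divff ?gt_eqF.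
have -> : riemann_sum g 1 n =
    \sum_(j < n) riemann_sum (fun=> g (j%:R * n%:R^-1)) n%:R^-1 m.
  rewrite [LHS]/riemann_sum mul1r scaler_sumr; apply: eq_bigr => j _.
  by rewrite riemann_sum_cst // mulr1.
rewrite {1}one_block riemann_sum_blocks -sumrB.
apply: le_trans (ler_rnorm_sum _ _ _) _.
have -> : e = \sum_(j < n) n%:R^-1 * e.
  by rewrite sumr_const card_ord -[_ *+ n]mulr_natl mulrA -one_block mul1r.
apply: ler_sum => j _; rewrite addrC -scaleN1r -riemann_sum_lincomb.
apply: rnorm_riemann_sum_le => // u /andP[u0 un].
rewrite scaleN1r addrC; apply: modulus.
  by rewrite ger0_norm // (le_lt_trans un).
by rewrite divr_ge0 //= ler_pdivrMr // mul1r ler_nat ltnW.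
Qed.

Lemma near_riemann_sum_refine g e : continuous g -> 0 < e ->
  \forall n \near \oo, (0 < n)%N /\ forall m, (0 < m)%N ->
    rnorm (riemann_sum g 1 (n * m) - riemann_sum g 1 n) <= e.
Proof.
move=> cg e0; have : \forall u \near (0 : R), forall c, 0 <= c <= 1 ->
    rnorm (g (u + c) - g (0 + c)) < e.
  apply: (near_uniform_segment (K := fun u c => g (u + c))) => // p.
  exact: cvg_comp (@add_continuous _ p) (cg _).
move=> [d /= d0 modulus]; near=> n.
have dn : d^-1 < n%:R by near: n; exact: nbhs_infty_gtr.
have n0 : 0 < n%:R :> R by rewrite (lt_trans _ dn) ?invr_gt0.
split=> [|m m0]; first by rewrite -(ltr0n R).
apply: (riemann_sum_refine (ltW e0) _ _ m0 (d := d)) => [u ud c c01||].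
- have := modulus u; rewrite /= sub0r normrN => /(_ ud c c01)/ltW.
  by rewrite add0r [u + c]addrC.
- by rewrite -(ltr0n R).
- by rewrite invf_plt.
Unshelve. all: by end_near. Qed.

End RiemannSums.

Section Integral.
Context {R : realType}.

Lemma eq_bochner0t {V : normedModType R[i]} (g1 g2 : R -> V) (t : R) : 0 <= t ->
  (forall s, 0 <= s <= t -> g1 s = g2 s) -> bochner0t g1 t = bochner0t g2 t.
Proof.
move=> t0 g12; rewrite /bochner0t.
by under eq_fun do rewrite -/(riemann_sum _ _ _) (eq_riemann_sum _ t0 g12).
Qed.

Lemma bochner0t_lim {V : normedModType R[i]} (g : R -> V) (t : R) (l : V) :
  riemann_sum g t n @[n --> \oo] --> l -> bochner0t g t = l.
Proof. by move=> gl; apply: (@cvg_lim V (@norm_hausdorff _ V)). Qed.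

Lemma bochner0t0 {V : normedModType R[i]} (g : R -> V) : bochner0t g 0 = 0.
Proof.
apply: bochner0t_lim.
by under eq_fun do rewrite /riemann_sum mul0r rmorph0 scale0r; exact: cvg_cst.
Qed.

Context {V : completeNormedModType R[i]}.
Implicit Types (g : R -> V) (s t h M e : R).

Lemma cvg_riemann_sum g t : continuous g ->
  riemann_sum g t n @[n --> \oo] --> bochner0t g t.
Proof.
move=> cg; suff : cvg (riemann_sum g t n @[n --> \oo]) by [].
under eq_fun do rewrite riemann_sum_scale.
apply: is_cvgZ; first exact: is_cvg_cst.
set k := fun c => g (c * t); have ck : continuous k.
  by move=> x; apply: (cvg_comp _ g _ (cg _)); exact: mulrr_continuous.
apply/cauchy_cvgP/cauchy_exP => _ /gt0_ofR[e e0 ->].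
have e3 : 0 < e / 3 by rewrite divr_gt0.
have refine := near_riemann_sum_refine ck e3.
have [N [N0 refineN]] := filter_ex refine.
exists (riemann_sum k 1 N); apply: filterS refine => n [n0 refine_n].
rewrite -ball_normE /ball_ /= normE ltr_ofR.
have -> : riemann_sum k 1 N - riemann_sum k 1 n =
  (riemann_sum k 1 (N * n) - riemann_sum k 1 n) -
  (riemann_sum k 1 (N * n) - riemann_sum k 1 N).
  by rewrite opprB [RHS]addrC addrA subrK.
apply: le_lt_trans (ler_rnormB _ _) _.
by have := refineN n n0; have := refine_n N N0; rewrite mulnC; lra.
Qed.

Lemma rnorm_bochner0t_le g t M : continuous g -> 0 <= t -> 0 <= M ->
  (forall s, 0 <= s <= t -> rnorm (g s) <= M) -> rnorm (bochner0t g t) <= t * M.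
Proof.
move=> cg t0 M0 gM; apply: cvg_rnorm_le (cvg_riemann_sum cg) _.
by near=> n; exact: rnorm_riemann_sum_le.
Unshelve. all: by end_near. Qed.

Lemma bochner0t_lincomb (a : R[i]) g1 g2 t : continuous g1 -> continuous g2 ->
  bochner0t (fun s => a *: g1 s + g2 s) t =
  a *: bochner0t g1 t + bochner0t g2 t.
Proof.
move=> cg1 cg2; apply: bochner0t_lim.
under eq_fun do rewrite riemann_sum_lincomb.
by apply: cvgD; [apply: cvgZ; [exact: cvg_cst|]|]; exact: cvg_riemann_sum.
Qed.

Lemma bochner0t_cst (v : V) t : bochner0t (fun=> v) t = ofR t *: v.
Proof.
apply: bochner0t_lim; apply: cvg_near_cst; near=> n.
by apply: riemann_sum_cst; near: n; exact: nbhs_infty_gt.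
Unshelve. all: by end_near. Qed.

Lemma bochner0t_linear {W : normedModType R[i]} (A : {linear V -> W}) g t :
  continuous A -> continuous g ->
  bochner0t (fun s => A (g s)) t = A (bochner0t g t).
Proof.
move=> cA cg; apply: bochner0t_lim.
under eq_fun do rewrite /riemann_sum -linear_sum -linearZ.
exact: cvg_comp (cvg_riemann_sum cg) (cA _).
Qed.

Lemma bochner0t_scale g t : continuous g ->
  bochner0t g t = ofR t *: bochner0t (fun c => g (c * t)) 1.
Proof.
move=> cg; apply: bochner0t_lim; under eq_fun do rewrite riemann_sum_scale.
apply: cvgZ; [exact: cvg_cst|]; apply: cvg_riemann_sum => c.
by apply: (cvg_comp _ g _ (cg _)); exact: mulrr_continuous.
Qed.

End Integral.

Definition is_right_derive (R : realType) (V : normedModType R[i])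
    (p : R -> V) (t : R) (l : V) : Prop :=
  ofR h^-1 *: (p (t + h) - p t) @[h --> 0^'+] --> l.

Section ParameterIntegral.
Context {R : realType}.

Lemma continuous_ofR : continuous (@ofR R : R -> Cplx R).
Proof.
move=> x; apply/cvg_rnormP => e e0.
have /cvgrPdist_lt/(_ e e0) : (y : R) @[y --> x] --> x by exact: cvg_id.
by apply: filterS => y; rewrite -rmorphB rnorm_ofR distrC.
Qed.

Lemma continuous_slice {T U W : topologicalType} (K : T -> U -> W) (u : T) :
  continuous (fun p => K p.1 p.2) -> continuous (K u).
Proof.
move=> cK c; apply: (cvg_comp (fun c => (u, c)) _ _ (cK (u, c))).
by apply: cvg_pair; [exact: cvg_cst|exact: cvg_id].
Qed.

Lemma continuous_comp_snd {T U W : topologicalType} (g : U -> W) :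
  continuous g -> continuous (fun p : T * U => g p.2).
Proof.
by move=> cg [x y]; apply: (cvg_comp _ g _ (cg y)); exact: cvg_snd.
Qed.

Lemma continuous_shift {T : topologicalType} (g : R -> T) (t : R) :
  continuous g -> continuous (fun s => g (t + s)).
Proof.
move=> cg s; apply: (cvg_comp _ g _ (cg _)).
by apply: cvgD; [exact: cvg_cst|exact: cvg_id].
Qed.

Context {V : completeNormedModType R[i]}.

Lemma continuous_param_bochner01 {T : topologicalType} (K : T -> R -> V) :
  continuous (fun p => K p.1 p.2) -> continuous (fun u => bochner0t (K u) 1).
Proof.
move=> cK u; apply/cvg_rnormP => e e0; have e2 : 0 < e / 2 by rewrite divr_gt0.
apply: filterS (near_uniform_segment u 0 1 cK e2) => u' K_near.
have -> : bochner0t (K u') 1 - bochner0t (K u) 1 =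
    bochner0t (fun c => -1 *: K u c + K u' c) 1.
  by rewrite bochner0t_lincomb ?scaleN1r 1?addrC //; exact: continuous_slice.
have cKB : continuous (fun c => -1 *: K u c + K u' c).
  move=> c; apply: cvgD; last exact: continuous_slice.
  by apply: cvgZ; [exact: cvg_cst|exact: continuous_slice].
have := @rnorm_bochner0t_le R V _ 1 (e / 2) cKB ler01 (ltW e2).
rewrite mul1r => /(_ _)/le_lt_trans; apply; last by lra.
by move=> c c01; rewrite scaleN1r addrC ltW ?K_near.
Qed.

Let rescale (K : R -> R -> V) (t c : R) := K t (c * t).

Let continuous_rescale (K : R -> R -> V) :
  continuous (fun p => K p.1 p.2) -> continuous (fun p => rescale K p.1 p.2).
Proof.
move=> cK [t c].
have mulr_pair : p.2 * p.1 @[p --> (t, c)] --> c * t.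
  by apply: cvgM; [exact: cvg_snd|exact: cvg_fst].
apply: (cvg_comp2 _ mulr_pair (cK (t, c * t))); exact: cvg_fst.
Qed.

Lemma continuous_param_bochner0t (K : R -> R -> V) :
  continuous (fun p => K p.1 p.2) -> continuous (fun t => bochner0t (K t) t).
Proof.
move=> cK; have -> : (fun t => bochner0t (K t) t) =
    fun t => ofR t *: bochner0t (rescale K t) 1.
  by apply/funext => t; rewrite bochner0t_scale //; exact: continuous_slice.
move=> t; apply: cvgZ; first exact: continuous_ofR.
exact: (continuous_param_bochner01 (continuous_rescale cK)).
Qed.

Lemma cvg_mean_bochner0t (K : R -> R -> V) :
  continuous (fun p => K p.1 p.2) ->
  ofR h^-1 *: bochner0t (K h) h @[h --> 0^'+] --> K 0 0.
Proof.
move=> cK; have /cvg_at_right_filter :=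
  @continuous_param_bochner01 _ _ (continuous_rescale cK) 0.
have -> : rescale K 0 = fun=> K 0 0.
  by apply/funext => c; rewrite /rescale mulr0.
rewrite bochner0t_cst rmorph1 scale1r; apply: cvg_trans.
apply: near_eq_cvg; near=> h; have h0 : 0 < h by [].
rewrite [in RHS]bochner0t_scale; last exact: continuous_slice.
by rewrite scalerA -rmorphM mulVf ?gt_eqF // rmorph1 scale1r.
Unshelve. all: by end_near. Qed.

End ParameterIntegral.

Section IntegralAdditivity.
Context {R : realType} {V : completeNormedModType R[i]}.
Implicit Types (g : R -> V) (s t h : R).

Lemma bochner0t_blocks g h p : continuous g ->
  bochner0t g (p%:R * h) = \sum_(j < p) bochner0t (fun u => g (j%:R * h + u)) h.
Proof.
move=> cg; case: (posnP p) => [->|p0].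
  by rewrite mul0r big_ord0 bochner0t0.
have cvg_whole : riemann_sum g (p%:R * h) (p * n) @[n --> \oo] -->
    bochner0t g (p%:R * h).
  exact: cvg_comp (cvg_mulnl _ p0) (cvg_riemann_sum cg).
apply: (norm_cvg_unique cvg_whole).
suff : riemann_sum g (p%:R * h) (p * n) @[n --> \oo] -->
  \sum_(j < p) bochner0t (fun u => g (j%:R * h + u)) h by [].
under eq_fun do rewrite riemann_sum_blocks.
apply: cvg_big => [|j _]; first exact: add_continuous.
exact/cvg_riemann_sum/continuous_shift.
Qed.

Lemma bochner0t_cat_commensurable g h p q : continuous g ->
  bochner0t g (p%:R * h + q%:R * h) =
  bochner0t g (p%:R * h) + bochner0t (fun u => g (p%:R * h + u)) (q%:R * h).
Proof.
move=> cg; rewrite -mulrDl -natrD !bochner0t_blocks //; last first.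
  exact: continuous_shift.
rewrite big_split_ord; congr (_ + _); apply: eq_bigr => j _.
by congr bochner0t; apply/funext => u; rewrite natrD mulrDl addrA.
Qed.

Lemma cvg_floor_multiples s t : 0 <= s -> 0 < t ->
  (Num.truncn (s / (t / n.+1%:R)))%:R * (t / n.+1%:R) @[n --> \oo] --> s.
Proof.
move=> s0 t0; apply/cvgrPdist_lt => e e0; near=> n.
set h := t / n.+1%:R; have h0 : 0 < h by rewrite divr_gt0.
have he : h < e.
  rewrite ltr_pdivrMr // mulrC -ltr_pdivrMr // (@lt_trans _ _ n%:R) ?ltr_nat //.
  by near: n; exact: nbhs_infty_gtr.
have /andP[] := truncn_itv (divr_ge0 s0 (ltW h0)).
rewrite ler_pdivlMr // ltr_pdivrMr // -natr1 mulrDl mul1r => floor_le lt_floor.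
by rewrite ger0_norm ?subr_ge0 //; lra.
Unshelve. all: by end_near. Qed.

Lemma continuous_bochner0t g : continuous g -> continuous (bochner0t g).
Proof.
move=> cg; apply: (continuous_param_bochner0t (K := fun=> g)).
exact: continuous_comp_snd.
Qed.

Lemma bochner0t_cat g s t : continuous g -> 0 <= t -> 0 <= s ->
  bochner0t g (t + s) = bochner0t g t + bochner0t (fun u => g (t + u)) s.
Proof.
move=> cg; rewrite le_eqVlt => /predU1P[<-|t0] s0.
  rewrite add0r bochner0t0 add0r; congr bochner0t.
  by apply/funext => u; rewrite add0r.
pose h n := t / n.+1%:R; pose q n := Num.truncn (s / h n).
have qh_s : (q n)%:R * h n @[n --> \oo] --> s := cvg_floor_multiples s0 t0.
have cvg_whole : bochner0t g (t + (q n)%:R * h n) @[n --> \oo] -->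
    bochner0t g (t + s).
  have t_qh_s : t + (q n)%:R * h n @[n --> \oo] --> t + s.
    by apply: cvgD qh_s; exact: cvg_cst.
  exact: (cvg_comp _ _ t_qh_s (@continuous_bochner0t _ cg _)).
have cvg_split : bochner0t g t + bochner0t (fun u => g (t + u)) ((q n)%:R * h n)
    @[n --> \oo] --> bochner0t g t + bochner0t (fun u => g (t + u)) s.
  apply: cvgD; first exact: cvg_cst.
  exact: (cvg_comp _ _ qh_s (@continuous_bochner0t _ (continuous_shift cg) _)).
apply: (norm_cvg_unique cvg_whole).
suff -> : (fun n => bochner0t g (t + (q n)%:R * h n)) = fun n =>
  bochner0t g t + bochner0t (fun u => g (t + u)) ((q n)%:R * h n) by [].
apply/funext => n; have {1 2 3}-> : t = n.+1%:R * h n by rewrite mulrC divfK.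
exact: bochner0t_cat_commensurable.
Qed.

Lemma bochner0t_right_derive g t : continuous g -> 0 <= t ->
  is_right_derive (bochner0t g) t (g t).
Proof.
move=> cg t0; have := cvg_mean_bochner0t (K := fun=> fun s => g (t + s))
  (continuous_comp_snd (continuous_shift (t := t) cg)).
rewrite addr0; apply: cvg_trans; apply: near_eq_cvg; near=> h.
by rewrite bochner0t_cat // addrAC subrr add0r.
Unshelve. all: by end_near. Qed.

End IntegralAdditivity.

Section RightDerivatives.
Context {R : realType}.

(* Tilting [q] by a small slope, its minimum over [a, b] can only be at [b]. *)
Lemma right_dini_nonincreasing (q : R -> R) (a b : R) :
  a <= b -> continuous q ->
  (forall t e, a <= t < b -> 0 < e ->
    \forall h \near 0^'+, q (t + h) <= q t + h * e) ->
  q b <= q a.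
Proof.
move=> ab cq dini; apply/ler_addgt0Pl => e e0.
pose slope := e / (b - a + 1); pose r t := q t - slope * t.
have slope0 : 0 < slope by rewrite divr_gt0 // ltr_wpDl // subr_ge0.
have cr : {within `[a, b], continuous r}.
  apply: continuous_subspaceT => x; apply: cvgB; first exact: cq.
  by apply: cvgM; [exact: cvg_cst|exact: cvg_id].
have [c c_ab min_c] := EVT_min ab cr.
have /andP[ac cb] : a <= c <= b by move: c_ab; rewrite in_itv.
have {cb} cb : c = b.
  move: cb; rewrite le_eqVlt => /predU1P[//|cb].
  have c_lt_b : a <= c < b by rewrite ac cb.
  have slope2 : 0 < slope / 2 by rewrite divr_gt0.
  have [h [h0 hb qh]] : exists h,
      [/\ 0 < h, h <= b - c & q (c + h) <= q c + h * (slope / 2)].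
    near (0 : R)^'+ => h; exists h; split=> //; near: h; last exact: dini.
    by apply: nbhs_right_le; rewrite subr_gt0.
  have : r c <= r (c + h) by apply: min_c; rewrite in_itv /=; lra.
  have := mulr_gt0 slope0 h0; rewrite /r mulrDr; lra.
have : r b <= r a by rewrite -{1}cb; apply: min_c; rewrite in_itv /= lexx.
have : slope * (b - a) <= e.
  by rewrite /slope mulrAC ler_pdivrMr ?ltr_wpDl ?subr_ge0 // ler_pM2l // lerDl.
rewrite /r; lra.
Unshelve. all: by end_near. Qed.

Lemma is_derive_right_slope (G : R -> R) (t l e : R) :
  is_derive t (1 : R) G l -> 0 < e ->
  \forall h \near 0^'+, G t + h * (l - e) <= G (t + h).
Proof.
move=> dG e0; have : h^-1 *: (G (h *: 1 + t) - G t) @[h --> 0^'] --> l.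
  rewrite -(derive_val (is_derive := dG)).
  exact: (ex_derive (is_derive := dG)).
move=> /cvg_dnbhs_at_right/cvgrPdist_lt/(_ _ e0).
apply: filterS2 (nbhs_right_gt 0) => h h0; rewrite ltr_norml => /andP[_].
rewrite /GRing.scale /= mulr1 [h + t]addrC ltrBlDr -ltrBlDl ltr_pdivlMl //.
by lra.
Qed.

Context {V : normedModType R[i]}.
Implicit Types (p : R -> V) (l : V).

Lemma is_right_derive_rnorm p t l e : is_right_derive p t l -> 0 < e ->
  \forall h \near 0^'+, rnorm (p (t + h)) <= rnorm (p t) + h * (rnorm l + e).
Proof.
move=> /cvg_rnormP pl e0; near=> h; have h0 : 0 < h by [].
have remainder : rnorm (ofR h^-1 *: (p (t + h) - p t) - l) <= e.
  by apply/ltW; near: h; exact: pl.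
have -> : p (t + h) =
    p t + ofR h *: (l + (ofR h^-1 *: (p (t + h) - p t) - l)).
  rewrite [l + _]addrC subrK scalerA -rmorphM divff ?gt_eqF //.
  by rewrite rmorph1 scale1r [RHS]addrC subrK.
apply: le_trans (ler_rnormD _ _) _.
rewrite lerD2l rnormZ rnorm_ofR gtr0_norm //.
by rewrite ler_pM2l // (le_trans (ler_rnormD _ _)) // lerD2l.
Unshelve. all: by end_near. Qed.

Lemma right_gronwall p (a b C : R) : a <= b -> 0 <= C -> continuous p ->
  (forall t, a <= t < b ->
    exists2 l, is_right_derive p t l & rnorm l <= C * rnorm (p t)) ->
  rnorm (p b) <= expR (C * (b - a)) * rnorm (p a).
Proof.
move=> ab C0 cp dp; pose q t := rnorm (p t) * expR (C * (a - t)).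
have cq : continuous q.
  move=> t; apply: cvgM.
    exact: (cvg_comp _ _ (cp t) (@continuous_rnorm _ _ _)).
  apply: (cvg_comp _ expR _ (@continuous_expR _ _)).
  by apply: cvgM; [|apply: cvgB; [|exact: cvg_id]]; exact: cvg_cst.
have : q b <= q a.
  apply: right_dini_nonincreasing => // t e t_ab e0.
  have [l dpl lC] := dp t t_ab.
  near=> h; have h0 : 0 < h by [].
  have p_growth : rnorm (p (t + h)) <= rnorm (p t) + h * (C * rnorm (p t) + e).
    apply: le_trans (_ : rnorm (p t) + h * (rnorm l + e) <= _).
      by near: h; exact: is_right_derive_rnorm.
    by rewrite lerD2l ler_pM2l // lerD2r.
  have exp1 : expR (C * (a - t)) <= 1.
    by rewrite -expR0 ler_expR mulr_ge0_le0 // subr_le0; case/andP: t_ab.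
  have expD : expR (C * (a - (t + h))) = expR (C * (a - t)) / expR (C * h).
    by rewrite -expRN -expRD; congr expR; ring.
  rewrite /q expD mulrA ler_pdivrMr ?expR_gt0 //.
  apply: le_trans (ler_wpM2r (expR_ge0 _) p_growth) _.
  have he_exp : h * e * expR (C * (a - t)) <= h * e.
    by rewrite ler_piMr // mulr_ge0 // ltW.
  have qe_ge0 : 0 <= q t + h * e.
    by rewrite addr_ge0 ?mulr_ge0 ?rnorm_ge0 ?expR_ge0 // ltW.
  apply: le_trans (ler_wpM2l qe_ge0 (expR_ge1Dx (C * h))).
  have : 0 <= h * e * (C * h) by rewrite !mulr_ge0 // ltW.
  by rewrite -/(q t) /q; lra.
rewrite /q subrr mulr0 expR0 mulr1 => /(ler_wpM2l (expR_ge0 (C * (b - a)))).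
rewrite mulrCA -expRD -mulrDr addrA subrK subrr mulr0 expR0 mulr1; exact.
Unshelve. all: by end_near. Qed.

Lemma right_mean_value_le p p' (G G' : R -> R) (a b : R) : a <= b ->
  continuous p -> (forall t, a <= t < b -> is_right_derive p t (p' t)) ->
  (forall t : R, is_derive t (1 : R) G (G' t)) ->
  (forall t, a <= t < b -> rnorm (p' t) <= G' t) ->
  rnorm (p b - p a) <= G b - G a.
Proof.
move=> ab cp dp dG p'G'; pose q t := rnorm (p t - p a) - G t.
have cq : continuous q.
  move=> t; apply: cvgB.
    exact: (cvg_comp _ _ (cvgB (cp t) (cvg_cst _)) (@continuous_rnorm _ _ _)).
  by apply: differentiable_continuous; apply/derivable1_diffP.
suff : q b <= q a by rewrite /q subrr rnorm0; lra.
apply: right_dini_nonincreasing => // t e t_ab e0.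
have e2 : 0 < e / 2 by rewrite divr_gt0.
have dpB : is_right_derive (fun t => p t - p a) t (p' t).
  rewrite /is_right_derive; under eq_fun do rewrite /= opprB addrA subrK.
  exact: dp.
have G_slope := is_derive_right_slope (dG t) e2.
near=> h.
have p_step : rnorm (p (t + h) - p a) <=
    rnorm (p t - p a) + h * (rnorm (p' t) + e / 2).
  by near: h; exact: is_right_derive_rnorm dpB _.
have G_step : G t + h * (G' t - e / 2) <= G (t + h) by near: h.
have : h * rnorm (p' t) <= h * G' t by rewrite ler_pM2l // p'G'.
rewrite /q; lra.
Unshelve. all: by end_near. Qed.

End RightDerivatives.

Definition conv_integrand (R : realType) (V : normedModType R[i])
    (phi : R -> Cplx R) (v : R -> V) (t s : R) : V :=
  (phi (t - s) : R[i]) *: v s.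

Definition conv0t (R : realType) (V : normedModType R[i])
    (phi : R -> Cplx R) (v : R -> V) (t : R) : V :=
  bochner0t (conv_integrand phi v t) t.

Section Convolution.
Context {R : realType}.

Lemma eq_conv0t {V : normedModType R[i]} (phi psi : R -> Cplx R) (v w : R -> V)
    (t : R) : 0 <= t ->
  (forall s, 0 <= s <= t -> phi s = psi s) ->
  (forall s, 0 <= s <= t -> v s = w s) -> conv0t phi v t = conv0t psi w t.
Proof.
move=> t0 phi_psi v_w; apply: eq_bochner0t => // s /andP[s0 st].
by rewrite /conv_integrand v_w ?s0 // phi_psi // subr_ge0 st gerBl.
Qed.

Context {V : completeNormedModType R[i]}.
Implicit Types (phi psi : R -> Cplx R) (v : R -> V) (h s t : R).

Lemma continuous_conv_integrand phi v : continuous phi -> continuous v ->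
  continuous (fun p : R * R => conv_integrand phi v p.1 p.2).
Proof.
move=> cphi cv [t s]; apply: cvgZ.
  exact: cvg_comp (@sub_continuous _ (t, s)) (cphi _).
exact: continuous_comp_snd.
Qed.

Lemma continuous_conv_integrandr phi v t : continuous phi -> continuous v ->
  continuous (conv_integrand phi v t).
Proof.
by move=> cphi cv; exact: continuous_slice (continuous_conv_integrand cphi cv).
Qed.

Lemma conv0t_lincomb (a : R[i]) phi psi v t :
  continuous phi -> continuous psi -> continuous v ->
  conv0t (fun s => a *: phi s + psi s) v t =
  a *: conv0t phi v t + conv0t psi v t.
Proof.
move=> cphi cpsi cv.
have cphi_v := continuous_conv_integrandr (t := t) cphi cv.
have cpsi_v := continuous_conv_integrandr (t := t) cpsi cv.
rewrite /conv0t -(bochner0t_lincomb a t cphi_v cpsi_v); congr bochner0t.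
by apply/funext => s; rewrite /conv_integrand scalerDl scalerA.
Qed.

Lemma conv0t_linear {W : normedModType R[i]} (A : {linear V -> W}) phi v t :
  continuous A -> continuous phi -> continuous v ->
  conv0t phi (fun s => A (v s)) t = A (conv0t phi v t).
Proof.
move=> cA cphi cv; rewrite /conv0t.
rewrite -bochner0t_linear //; last exact: continuous_conv_integrandr.
by congr bochner0t; apply/funext => s; rewrite /conv_integrand linearZ.
Qed.

Lemma conv0t_cat phi v h t :
  continuous phi -> continuous v -> 0 <= h -> 0 <= t ->
  conv0t phi v (h + t) =
  conv0t phi (fun s => v (h + s)) t + conv0t (fun s => phi (t + s)) v h.
Proof.
move=> cphi cv h0 t0; rewrite /conv0t bochner0t_cat //; last first.
  exact: continuous_conv_integrandr.
rewrite [LHS]addrC /conv_integrand; congr (_ + _).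
  by apply: eq_bochner0t => // s _; rewrite [h + t]addrC addrKA.
by apply: eq_bochner0t => // s _; rewrite addrAC addrC.
Qed.

Lemma rnorm_conv0t_le phi v t M N : continuous phi -> continuous v -> 0 <= t ->
  0 <= M -> 0 <= N ->
  (forall s, 0 <= s <= t -> rnorm (phi s) <= M) ->
  (forall s, 0 <= s <= t -> rnorm (v s) <= N) ->
  rnorm (conv0t phi v t) <= t * (M * N).
Proof.
move=> cphi cv t0 M0 N0 phiM vN; apply: rnorm_bochner0t_le => // [||s s_t].
- exact: continuous_conv_integrandr.
- exact: mulr_ge0.
rewrite rnormZ ler_pM ?rnorm_ge0 ?vN //; apply: phiM.
by case/andP: s_t => s0 st; rewrite subr_ge0 st gerBl.
Qed.

Lemma continuous_conv0t phi v : continuous phi -> continuous v ->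
  continuous (conv0t phi v).
Proof.
move=> cphi cv.
exact: continuous_param_bochner0t (continuous_conv_integrand cphi cv).
Qed.

Lemma cvg_mean_conv0t phi v : continuous phi -> continuous v ->
  ofR h^-1 *: conv0t phi v h @[h --> 0^'+] --> (phi 0 : R[i]) *: v 0.
Proof.
move=> cphi cv; have := cvg_mean_bochner0t (continuous_conv_integrand cphi cv).
by rewrite /conv_integrand subr0.
Qed.

Lemma rnorm_conv0t_expR phi v t (l m N : R) : continuous phi -> continuous v ->
  0 <= t -> 0 < l -> 0 <= m -> 0 <= N ->
  (forall s, 0 <= s <= t -> rnorm (phi s) <= m * expR (l * s)) ->
  (forall s, 0 <= s <= t -> rnorm (v s) <= N) ->
  rnorm (conv0t phi v t) <= m * N / l * expR (l * t).
Proof.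
move=> cphi cv t0 l0 m0 N0 phi_exp vN.
have ck := continuous_conv_integrandr (t := t) cphi cv.
pose G s := - (m * N / l) * expR (l * (t - s)).
pose G' s := m * N * expR (l * (t - s)).
have dG s : is_derive s (1 : R) G (G' s).
  have dlin : is_derive s (1 : R) (fun s => l * (t - s)) (- l).
    by apply: is_derive_eq; rewrite /GRing.scale /=; ring.
  by apply: is_derive_eq; rewrite /GRing.scale /= /G'; field; rewrite gt_eqF.
have integrand_le s : 0 <= s < t -> rnorm (conv_integrand phi v t s) <= G' s.
  move=> /andP[s0 st]; rewrite rnormZ /G' mulrAC ler_pM ?rnorm_ge0 //.
    by apply: phi_exp; rewrite subr_ge0 ltW ?gerBl.
  by apply: vN; rewrite s0 ltW.
have dI s : 0 <= s < t ->
    is_right_derive (bochner0t (conv_integrand phi v t)) s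
      (conv_integrand phi v t s).
  by case/andP=> s0 _; exact: bochner0t_right_derive.
have := right_mean_value_le t0 (continuous_bochner0t ck) dI dG integrand_le.
rewrite bochner0t0 subr0 => /le_trans; apply.
rewrite /G subrr subr0 mulr0 expR0 !mulNr opprK mulr1 gerDr oppr_le0.
by rewrite divr_ge0 ?mulr_ge0 // ltW.
Qed.

Lemma expR_weighted_max {W : normedModType R[i]} (p : R -> W) (l T : R) :
  0 <= T -> continuous p ->
  exists2 c, 0 <= c <= T & forall t, 0 <= t <= T ->
    rnorm (p t) <= rnorm (p c) * expR (l * (t - c)).
Proof.
move=> T0 cp.
have [|c cT max_c] :=
    @EVT_max _ (fun t => rnorm (p t) * expR (- (l * t))) 0 T T0.
  apply: continuous_subspaceT => t; apply: cvgM.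
    exact: (cvg_comp _ _ (cp t) (@continuous_rnorm _ _ _)).
  apply: (cvg_comp _ expR _ (@continuous_expR _ _)).
  by apply: cvgN; apply: cvgM; [exact: cvg_cst|exact: cvg_id].
exists c => [|t tT]; first by move: cT; rewrite in_itv.
rewrite mulrBr addrC expRD mulrA -ler_pdivrMr ?expR_gt0 // -expRN.
by apply: max_c; rewrite in_itv.
Qed.

(* The integral term is a contraction for the sup norm on [0, T] weighted by
   exp (- l t), once l is large. *)
Lemma volterra_bound (B : V -> Cplx R) v (b T : R) :
  (forall x, rnorm (B x) <= b * rnorm x) -> 0 <= b -> continuous v -> 0 <= T ->
  exists2 K : R, 0 <= K & forall phi A, continuous phi -> 0 <= A ->
    (forall t, 0 <= t <= T -> rnorm (phi t + B (conv0t phi v t)) <= A) ->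
    forall t, 0 <= t <= T -> rnorm (phi t) <= K * A.
Proof.
move=> Bb b0 cv T0; have [N N0 vN] := rnorm_bounded_segment 0 T cv.
pose l := 2 * b * N + 1; have l0 : 0 < l by rewrite ltr_wpDl // !mulr_ge0.
exists (2 * expR (l * T)) => [|phi A cphi A0 phiA].
  by rewrite mulr_ge0 ?expR_ge0.
have [c cT max_c] := expR_weighted_max l T0 cphi.
pose m := rnorm (phi c) * expR (- (l * c)).
have m0 : 0 <= m by rewrite mulr_ge0 ?rnorm_ge0 ?expR_ge0.
have phi_m t : 0 <= t <= T -> rnorm (phi t) <= m * expR (l * t).
  by move=> tT; rewrite /m -mulrA -expRD addrC -mulrBr max_c.
have phi_le t : 0 <= t <= T -> rnorm (phi t) <= A + m / 2 * expR (l * t).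
  move=> tT; have [t0 t_T] := andP tT.
  have conv_le : rnorm (conv0t phi v t) <= m * N / l * expR (l * t).
    apply: rnorm_conv0t_expR => // s /andP[s0 st]; first by apply: phi_m; lra.
    by apply: vN; lra.
  have half : b * (m * N / l) <= m / 2.
    by rewrite mulrA ler_pdivrMr // /l; nra.
  rewrite -[phi t](addrK (B (conv0t phi v t))).
  apply: le_trans (ler_rnormB _ _) (lerD (phiA t tT) (le_trans (Bb _) _)).
  apply: le_trans (ler_wpM2l b0 conv_le) _.
  by rewrite mulrA ler_wpM2r ?expR_ge0.
have mA : m <= 2 * A.
  have := ler_wpM2r (expR_ge0 (- (l * c))) (phi_le c cT).
  rewrite -/m mulrDl -[_ / 2 * _ * _]mulrA -expRD subrr expR0 mulr1.
  have : A * expR (- (l * c)) <= A.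
    rewrite ler_piMr // -[leRHS]expR0 ler_expR oppr_le0 mulr_ge0 ?(ltW l0) //.
    by case/andP: cT.
  by lra.
move=> t tT; apply: le_trans (phi_m t tT) _; rewrite [leRHS]mulrAC.
rewrite ler_pM ?expR_ge0 // ler_expR ler_wpM2l ?(ltW l0) //.
by case/andP: tT.
Qed.

Lemma volterra_unique (B : {linear V -> Cplx R}) v phi psi :
  continuous B -> continuous v -> continuous phi -> continuous psi ->
  (forall t, 0 <= t ->
    phi t + B (conv0t phi v t) = psi t + B (conv0t psi v t)) ->
  forall t, 0 <= t -> phi t = psi t.
Proof.
move=> cB cv cphi cpsi phi_psi t t0.
have [b b0 Bb] := continuous_linear_bound cB.
have [K _ bound] := volterra_bound Bb b0 cv t0.
pose d s := -1 *: psi s + phi s.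
have cd : continuous d.
  by move=> s; apply: cvgD (cphi s); apply: cvgZ (cpsi s); exact: cvg_cst.
have d_eq s : 0 <= s -> d s + B (conv0t d v s) = 0.
  move=> s0; have -> : conv0t d v s = -1 *: conv0t psi v s + conv0t phi v s.
    exact: (conv0t_lincomb (-1) s cpsi cphi cv).
  by rewrite /d linearP addrACA -scalerDr -phi_psi // scaleN1r addNr.
suff /rnorm_eq0/eqP : rnorm (d t) = 0.
  by rewrite /d scaleN1r addrC subr_eq0 => /eqP.
apply/eqP; rewrite eq_le rnorm_ge0 andbT -(mulr0 K); apply: bound => //.
  by move=> s /andP[s0 _]; rewrite d_eq // rnorm0.
by rewrite t0 lexx.
Qed.

End Convolution.

Definition linear_pack (K : pzRingType) (V W : lmodType K) (A : V -> W)
    (linA : linear A) : {linear V -> W} :=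
  HB.pack A (GRing.isLinear.Build K V W _ A linA).

Definition memory_functional (R : realType) (H : normedModType R[i])
    (ip : H -> H -> R[i]) (z w x : H) : Cplx R :=
  ip x (projQ ip z w) / ip z z.

Section InnerProduct.
Context {R : realType} {H : normedModType R[i]} {ip : H -> H -> R[i]}.
Hypothesis ip_inner : is_inner_product ip.
Implicit Types (a : R[i]) (w x y z : H).

Lemma ip_is_linear w : linear (ip^~ w : H -> Cplx R).
Proof. by move=> a x y; case: ip_inner => ->. Qed.

Lemma ip_conj x y : ip y x = (ip x y)^*.
Proof. by case: ip_inner. Qed.

Lemma ip_norm x : ip x x = `|x| ^+ 2.
Proof. by case: ip_inner. Qed.

Lemma ip0l w : ip 0 w = 0.
Proof. exact: linear0 (linear_pack (ip_is_linear w)). Qed.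

Lemma ipDl x y w : ip (x + y) w = ip x w + ip y w.
Proof. exact: linearD (linear_pack (ip_is_linear w)) x y. Qed.

Lemma ipBl x y w : ip (x - y) w = ip x w - ip y w.
Proof. exact: linearB (linear_pack (ip_is_linear w)) x y. Qed.

Lemma ipZl a x w : ip (a *: x) w = a * ip x w.
Proof. exact: (linearZZ (linear_pack (ip_is_linear w)) a x). Qed.

Lemma ipBr x y w : ip w (x - y) = ip w x - ip w y.
Proof. by rewrite ip_conj ipBl [LHS]rmorphB /= -!ip_conj. Qed.

Lemma ipZr a x w : ip w (a *: x) = a^* * ip w x.
Proof. by rewrite ip_conj ipZl [LHS]rmorphM /= -ip_conj. Qed.

Lemma ip_neq0 x : x != 0 -> ip x x != 0.
Proof. by move=> x0; rewrite ip_norm expf_eq0 /= normr_eq0. Qed.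

Lemma cauchy_schwarz x y : rnorm (ip x y) <= rnorm x * rnorm y.
Proof.
have [->|y0] := eqVneq y 0; first by rewrite ip_conj ip0l rmorph0 !rnorm0 mulr0.
set a := ip x y; set n := ip y y.
have n_gt0 : 0 < n by rewrite /n ip_norm exprn_gt0 // normr_gt0.
have : 0 <= ip (n *: x - a *: y) (n *: x - a *: y) by rewrite ip_norm exprn_ge0.
rewrite !(ipBl, ipBr) !(ipZl, ipZr) -/a -/n.
rewrite -(ip_conj y y) (ip_conj x y) -/a -/n.
rewrite [X in _ <= X](_ : _ = n * (ip x x * n - a * a^*)); last by ring.
rewrite pmulr_rge0 // subr_ge0 -normCK /n !ip_norm -exprMn.
by rewrite ler_pXn2r // ?nnegrE ?mulr_ge0 // !normE -rmorphM ler_ofR.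
Qed.

Lemma continuous_ip w : continuous (ip^~ w : H -> Cplx R).
Proof.
apply: (linear_bound_continuous (A := linear_pack (ip_is_linear w))
  (M := rnorm w)).
by move=> x; rewrite mulrC; exact: cauchy_schwarz.
Qed.

Lemma ip_projP z x : z != 0 -> ip (projP ip z x) z = ip x z.
Proof. by move=> z0; rewrite ipZl divfK // ip_neq0. Qed.

Lemma ip_projQ z x : z != 0 -> ip (projQ ip z x) z = 0.
Proof. by move=> z0; rewrite ipBl ip_projP ?subrr. Qed.

Lemma projP_is_linear z : linear (projP ip z).
Proof.
move=> a x y; rewrite /projP ipDl ipZl mulrDl scalerDl scalerA.
by rewrite -mulrA.
Qed.

Lemma projQ_is_linear z : linear (projQ ip z).
Proof.
by move=> a x y; rewrite /projQ projP_is_linear scalerBr opprD addrACA.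
Qed.

Lemma projP_bound z :
  exists2 p : R, 0 <= p & forall x, rnorm (projP ip z x) <= p * rnorm x.
Proof.
apply: (continuous_linear_bound (A := linear_pack (projP_is_linear z))) => x.
apply: cvgZ; last exact: cvg_cst.
exact: (cvg_comp _ _ (@continuous_ip z x) (@mulrr_continuous R[i] _ _)).
Qed.

Lemma projQ_bound z :
  exists2 q : R, 0 <= q & forall x, rnorm (projQ ip z x) <= q * rnorm x.
Proof.
have [p p0 Pp] := projP_bound z.
exists (1 + p) => [|x]; first by rewrite addr_ge0.
by apply: le_trans (ler_rnormB _ _) _; rewrite mulrDl mul1r lerD2l.
Qed.

Lemma memory_functional_is_linear z w : linear (memory_functional ip z w).
Proof.
by move=> a x y; rewrite /memory_functional ipDl ipZl mulrDl -mulrA.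
Qed.

Lemma continuous_memory_functional z w :
  continuous (memory_functional ip z w).
Proof.
move=> x.
exact: (cvg_comp _ _ (@continuous_ip _ x) (@mulrr_continuous R[i] _ _)).
Qed.

End InnerProduct.

Definition orthogonal_dynamics (R : realType) (H : normedModType R[i])
    (ip : H -> H -> R[i]) (U : R -> H -> H) (z : H) (F : H -> R -> Cplx R)
    (x : H) (t : R) : H :=
  U t (projQ ip z x) - conv0t (F x) (U^~ z) t.

Definition projected_dynamics (R : realType) (H : normedModType R[i])
    (ip : H -> H -> R[i]) (U : R -> H -> H) (z : H) (F : H -> R -> Cplx R)
    (t : R) (x : H) : H :=
  projP ip z x + U t (projQ ip z x) - conv0t (F x) (U^~ z) t.

Section Semigroup.
Context {R : realType} {H : completeNormedModType R[i]}.
Context {U : R -> {linear H -> H}}.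
Hypothesis continuous_U : forall t, continuous (U t).
Hypothesis continuous_orbit : forall x, continuous (fun t => U t x).
Hypothesis U0 : forall x, U 0 x = x.
Hypothesis UD : forall (s t : R) x,
  0 <= s -> 0 <= t -> U (s + t) x = U s (U t x).
Implicit Types (x y : H) (s t h : R).

Lemma semigroup_locally_bounded (T : R) :
  exists2 M : R, 0 <= M &
    forall t x, 0 <= t <= T -> rnorm (U t x) <= M * rnorm x.
Proof.
have [i|x|M M0 UM] := @uniform_boundedness R H H {t : R | 0 <= t <= T}
  (fun i => U (sval i)).
- exact: continuous_U.
- have [M _ orbitM] := rnorm_bounded_segment 0 T (@continuous_orbit x).
  by exists M => -[t tT]; exact: orbitM.
by exists M => // t x tT; exact: (UM (exist _ t tT)).
Qed.

Lemma semigroup_bochner0t y h t : 0 <= h -> 0 <= t ->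
  U h (bochner0t (U^~ y) t) = bochner0t (U^~ y) (t + h) - bochner0t (U^~ y) h.
Proof.
move=> h0 t0; have cy := @continuous_orbit y.
rewrite [t + h]addrC (bochner0t_cat cy h0 t0) addrAC subrr add0r.
rewrite -(bochner0t_linear t (@continuous_U h) cy).
by apply: eq_bochner0t => // s /andP[s0 _]; rewrite UD.
Qed.

Lemma diff_quot_bochner0t y t : 0 <= t ->
  diff_quot U (bochner0t (U^~ y) t) h @[h --> 0^'+] --> U t y - y.
Proof.
move=> t0; have cy := @continuous_orbit y.
rewrite -[X in _ - X]U0.
apply: cvg_trans (cvgB (bochner0t_right_derive cy t0)
  (bochner0t_right_derive cy (lexx 0))).
apply: near_eq_cvg; near=> h.
rewrite !fctE add0r bochner0t0 subr0 -scalerBr /diff_quot.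
by rewrite semigroup_bochner0t // addrAC.
Unshelve. all: by end_near. Qed.

Lemma conv0t_semigroup (phi : R -> Cplx R) x h t :
  continuous phi -> 0 <= h -> 0 <= t ->
  conv0t phi (U^~ x) (h + t) =
  U h (conv0t phi (U^~ x) t) + conv0t (fun s => phi (t + s)) (U^~ x) h.
Proof.
move=> cphi h0 t0; rewrite (conv0t_cat cphi (@continuous_orbit x) h0 t0).
congr (_ + _).
rewrite -(conv0t_linear t (@continuous_U h) cphi (@continuous_orbit x)).
by apply: eq_conv0t => // s /andP[s0 _]; rewrite UD.
Qed.

Context {ip : H -> H -> R[i]} {z Ldz : H}.
Hypothesis ip_inner : is_inner_product ip.
Hypothesis z_neq0 : z != 0.
Hypothesis z_adjoint : is_gen_adjoint ip U z Ldz.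

Lemma semigroup_adjoint y t : 0 <= t ->
  ip (U t y) z = ip y z + ip (bochner0t (U^~ y) t) Ldz.
Proof.
move=> t0; have quot := @diff_quot_bochner0t y t t0.
rewrite -z_adjoint; last by exists (U t y - y).
rewrite /sg_gen (cvg_lim (@norm_hausdorff _ H) quot) (ipBl ip_inner).
by rewrite addrC subrK.
Qed.

Local Notation P := (projP ip z).
Local Notation Q := (projQ ip z).
Local Notation v := (fun s : R => U s z).
Let B : {linear H -> Cplx R} :=
  linear_pack (memory_functional_is_linear ip_inner z Ldz).

Let continuous_B : continuous B.
Proof. exact: continuous_memory_functional. Qed.

Let continuous_v : continuous v.
Proof. exact: continuous_orbit. Qed.

Context {F : H -> R -> Cplx R}.
Hypothesis continuous_F : forall x, continuous (F x).
Hypothesis F_eq : forall x t, 0 <= t ->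
  F x t = memory_functional ip z Ldz (U t (projQ ip z x)) -
    conv0t (F x) (fun s => memory_functional ip z Ldz (U s z)) t.

Local Notation Y := (orthogonal_dynamics ip U z F).
Local Notation G := (projected_dynamics ip U z F).

Lemma memory_volterra x t : 0 <= t ->
  F x t + B (conv0t (F x) v t) = B (U t (Q x)).
Proof.
move=> t0; rewrite F_eq //.
by rewrite (conv0t_linear t continuous_B (@continuous_F x) continuous_v) subrK.
Qed.

Lemma memoryE x t : 0 <= t -> F x t = B (Y x t).
Proof.
by move=> t0; rewrite /orthogonal_dynamics linearB -memory_volterra // addrK.
Qed.

Lemma orthogonal_dynamicsD x h t : 0 <= h -> 0 <= t ->
  Y x (h + t) = U h (Y x t) - conv0t (fun s => F x (t + s)) v h.
Proof.
move=> h0 t0; rewrite /orthogonal_dynamics UD // conv0t_semigroup //.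
by rewrite (linearB (U h)) opprD addrA.
Qed.

Lemma continuous_orthogonal_dynamics x : continuous (Y x).
Proof.
move=> t; apply: cvgB; first exact: continuous_orbit.
exact: (@continuous_conv0t _ _ _ _ (@continuous_F x) continuous_v).
Qed.

Lemma orthogonal_dynamics_right_derive x t : 0 <= t ->
  is_right_derive (fun t => ip (Y x t) z : Cplx R) t
    ((ip Ldz z / ip z z)^* * ip (Y x t) z).
Proof.
move=> t0; set y := Y x t.
have mean_orbit : ofR h^-1 *: bochner0t (U^~ y) h @[h --> 0^'+] --> y.
  have := bochner0t_right_derive (@continuous_orbit y) (lexx 0).
  rewrite /is_right_derive U0.
  by under eq_fun do rewrite add0r bochner0t0 subr0.
have mean_memory : ofR h^-1 *: conv0t (fun s => F x (t + s)) v h @[h --> 0^'+]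
    --> (F x t : R[i]) *: z.
  have cF := continuous_shift (t := t) (@continuous_F x).
  have := cvg_mean_conv0t cF continuous_v.
  by rewrite addr0 U0.
have -> : (ip Ldz z / ip z z)^* * ip y z =
    ip y Ldz - ip ((F x t : R[i]) *: z) z.
  rewrite (ipZl ip_inner) memoryE // divfK ?(ip_neq0 ip_inner) //.
  by rewrite (ipBr ip_inner) (ipZr ip_inner) opprB addrC subrK.
apply: cvg_trans (cvgB
  (cvg_comp _ _ mean_orbit (@continuous_ip _ _ _ ip_inner Ldz y))
  (cvg_comp _ _ mean_memory (@continuous_ip _ _ _ ip_inner z _))).
apply: near_eq_cvg; near=> h; rewrite !fctE /= !(ipZl ip_inner).
rewrite [t + h]addrC orthogonal_dynamicsD // (ipBl ip_inner).
by rewrite semigroup_adjoint // /GRing.scale /=; ring.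
Unshelve. all: by end_near. Qed.

Lemma orthogonal_dynamics_orthogonal x t : 0 <= t -> ip (Y x t) z = 0.
Proof.
move=> t0; set kappa := (ip Ldz z / ip z z)^*.
have cp : continuous (fun t => ip (Y x t) z : Cplx R).
  move=> s; exact: (cvg_comp _ _ (@continuous_orthogonal_dynamics x s)
    (@continuous_ip _ _ _ ip_inner z _)).
have growth s : 0 <= s < t -> exists2 l,
    is_right_derive (fun t => ip (Y x t) z : Cplx R) s l &
    rnorm l <= rnorm kappa * rnorm (ip (Y x s) z : Cplx R).
  move=> /andP[s0 _]; exists (kappa * ip (Y x s) z); last by rewrite rnormM.
  exact: orthogonal_dynamics_right_derive.
have := right_gronwall t0 (rnorm_ge0 kappa) cp growth.
have -> : ip (Y x 0) z = 0.
  by rewrite /orthogonal_dynamics U0 /conv0t bochner0t0 subr0 ip_projQ.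
rewrite rnorm0 mulr0 => norm_le0; apply/rnorm_eq0/eqP.
by rewrite eq_le norm_le0 rnorm_ge0.
Qed.

Lemma projected_dynamicsE t x : G t x = P x + Y x t.
Proof. by rewrite /projected_dynamics -addrA. Qed.

Lemma projP_projected_dynamics t x : 0 <= t -> P (G t x) = P x.
Proof.
move=> t0; rewrite projected_dynamicsE {1}/projP (ipDl ip_inner).
by rewrite orthogonal_dynamics_orthogonal // addr0 ip_projP.
Qed.

Lemma projQ_projected_dynamics t x : 0 <= t -> Q (G t x) = Y x t.
Proof.
move=> t0; rewrite {1}/projQ projP_projected_dynamics //.
by rewrite projected_dynamicsE addrC addKr.
Qed.

Lemma memory_shift t x s : 0 <= t -> 0 <= s -> F x (t + s) = F (G t x) s.
Proof.
move=> t0; apply: (volterra_unique (phi := fun s => F x (t + s)) continuous_B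
  continuous_v) => //; first exact: continuous_shift.
move=> {}s s0; rewrite memory_volterra // projQ_projected_dynamics //.
rewrite [t + s]addrC memoryE ?addr_ge0 // orthogonal_dynamicsD //.
by rewrite linearB subrK.
Qed.

Lemma projected_dynamicsD s t x : 0 <= s -> 0 <= t -> G (s + t) x = G s (G t x).
Proof.
move=> s0 t0; rewrite [LHS]projected_dynamicsE [RHS]projected_dynamicsE.
rewrite projP_projected_dynamics // orthogonal_dynamicsD //.
rewrite [in RHS]/orthogonal_dynamics projQ_projected_dynamics //.
congr (_ + (_ - _)).
by apply: eq_conv0t => // r /andP[r0 _]; rewrite memory_shift.
Qed.

Lemma memory_linear a x y t : 0 <= t -> F (a *: x + y) t = a *: F x t + F y t.
Proof.
pose lincomb s := a *: F x s + F y s.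
have clincomb : continuous lincomb.
  move=> s; apply: cvgD (@continuous_F y s); apply: cvgZ (@continuous_F x s).
  exact: cvg_cst.
have conv_lincomb s :
    conv0t lincomb v s = a *: conv0t (F x) v s + conv0t (F y) v s.
  exact: (conv0t_lincomb a s (@continuous_F x) (@continuous_F y)
    continuous_v).
apply: (volterra_unique continuous_B continuous_v
  (@continuous_F (a *: x + y)) clincomb) => {}t t0.
rewrite memory_volterra // conv_lincomb projQ_is_linear // !linearP.
by rewrite addrACA -scalerDr !memory_volterra.
Qed.

Lemma projected_dynamics_linear t a x y : 0 <= t ->
  G t (a *: x + y) = a *: G t x + G t y.
Proof.
move=> t0; rewrite /projected_dynamics projP_is_linear // projQ_is_linear //.
rewrite linearP.
rewrite (@eq_conv0t _ _ _ (fun s => a *: F x s + F y s) _ v) //; last first.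
  by move=> s /andP[s0 _]; exact: memory_linear.
rewrite (conv0t_lincomb a t (@continuous_F x) (@continuous_F y)) //.
by rewrite opprD [X in X + _ = _]addrACA [LHS]addrACA scalerBr scalerDr.
Qed.

Lemma memory_bounded t : 0 <= t -> exists2 K : R, 0 <= K &
  forall x s, 0 <= s <= t -> rnorm (F x s) <= K * rnorm x.
Proof.
move=> t0; have [M M0 UM] := semigroup_locally_bounded t.
have [b b0 Bb] := continuous_linear_bound continuous_B.
have [q q0 Qq] := projQ_bound ip_inner z.
have [K K0 bound] := volterra_bound Bb b0 continuous_v t0.
exists (K * (b * (M * q))) => [|x s s_t]; first by rewrite !mulr_ge0.
rewrite -!mulrA; apply: bound (s_t) => // [|r r_t].
  by rewrite !mulr_ge0 ?rnorm_ge0.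
rewrite memory_volterra; last by case/andP: r_t.
apply: le_trans (Bb _) _; rewrite ler_wpM2l //.
by apply: le_trans (UM _ _ r_t) _; rewrite ler_wpM2l ?Qq.
Qed.

Lemma projected_dynamics_bounded t : 0 <= t ->
  exists M : R, forall x, rnorm (G t x) <= M * rnorm x.
Proof.
move=> t0; have [M M0 UM] := semigroup_locally_bounded t.
have [p _ Pp] := projP_bound ip_inner z.
have [q _ Qq] := projQ_bound ip_inner z.
have [K K0 FK] := memory_bounded t0.
exists (p + M * q + t * (K * (M * rnorm z))) => x.
have UQ_le : rnorm (U t (Q x)) <= M * q * rnorm x.
  apply: le_trans (UM t _ _) _; first by rewrite t0 lexx.
  by rewrite -mulrA; exact: (ler_wpM2l M0 (Qq x)).
have conv_le : rnorm (conv0t (F x) v t) <= t * (K * rnorm x * (M * rnorm z)).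
  apply: (rnorm_conv0t_le (@continuous_F x) continuous_v) => //.
  - by rewrite mulr_ge0 ?rnorm_ge0.
  - by rewrite mulr_ge0 ?rnorm_ge0.
  - exact: FK.
  - by move=> s; exact: UM.
apply: le_trans (ler_rnormB _ _) _.
apply: le_trans (lerD (ler_rnormD _ _) conv_le) _.
by have := Pp x; rewrite !mulrDl /=; lra.
Qed.

Lemma continuous_projected_dynamics x : continuous (fun t => G t x).
Proof.
have -> : (fun t => G t x) = fun t => P x + Y x t.
  by apply/funext => t; exact: projected_dynamicsE.
move=> t; apply: cvgD; first exact: cvg_cst.
exact: continuous_orthogonal_dynamics.
Qed.

Lemma projected_dynamics0 x : G 0 x = x.
Proof.
by rewrite /projected_dynamics U0 /conv0t bochner0t0 subr0 addrC subrK.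
Qed.

Lemma projected_dynamics_C0_semigroup : C0_semigroup G.
Proof.
split.
- move=> t t0; split=> [a x y|]; first exact: projected_dynamics_linear.
  have [M GM] := projected_dynamics_bounded t0; exists (ofR M) => x.
  by rewrite !normE -rmorphM ler_ofR.
- exact: projected_dynamics0.
- by move=> s t x; exact: projected_dynamicsD.
- by move=> x; exact/continuous_subspaceT/continuous_projected_dynamics.
Qed.

End Semigroup.

Section Extension.
Context {R : realType}.

Lemma continuous_comp_max0 {T : topologicalType} (g : R -> T) :
  {within `[0, +oo[, continuous g} -> continuous (fun t : R => g (Num.max 0 t)).
Proof.
move=> /subspace_continuousP cg t.
have halfline (s : R) : `[0, +oo[%classic (Num.max 0 s).
  by rewrite set_itvE /mkset le_max lexx.
have cmax : Num.max 0 s @[s --> t] --> Num.max 0 t.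
  apply: (continuous_max (f := fun=> 0) (g := id)); first exact: cvg_cst.
  exact: cvg_id.
have max_t : Num.max 0 s @[s --> t] --> within `[0, +oo[ (nbhs (Num.max 0 t)).
  by move=> A wA; apply: (@filterS _ (nbhs t)) (cmax _ wA) => s; apply.
exact: (cvg_comp _ _ max_t (cg _ (halfline t))).
Qed.

Context {H : normedModType R[i]}.
Implicit Types U V : R -> H -> H.

Lemma eq_C0_semigroup U V : (forall t x, 0 <= t -> U t x = V t x) ->
  C0_semigroup U -> C0_semigroup V.
Proof.
move=> UV [U_lin U0 UD Uc]; split.
- move=> t t0; have [U_linear [M UM]] := U_lin t t0.
  by split=> [a x y|]; [rewrite -!UV|exists M => x; rewrite -UV].
- by move=> x; rewrite -UV.
- by move=> s t x s0 t0; rewrite -!UV ?addr_ge0 // UD.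
move=> x; apply: subspace_eq_continuous (Uc x) => t.
by rewrite inE /= in_itv /= andbT; exact: UV.
Qed.

Lemma eq_is_gen_adjoint (ip : H -> H -> R[i]) U V (z w : H) :
  (forall t x, 0 <= t -> U t x = V t x) ->
  is_gen_adjoint ip U z w -> is_gen_adjoint ip V z w.
Proof.
move=> UV adj x [y quotV]; have quotU : diff_quot U x h @[h --> 0^'+] --> y.
  apply: cvg_trans quotV; apply: near_eq_cvg; near=> h.
  by rewrite /diff_quot UV.
have hausdorffH := @norm_hausdorff _ H.
rewrite /sg_gen (cvg_lim hausdorffH quotV) -(cvg_lim hausdorffH quotU).
by apply: adj; exists y.
Unshelve. all: by end_near. Qed.

Lemma C0_semigroup_extension U : C0_semigroup U ->
  exists V : R -> {linear H -> H},
    [/\ forall t, continuous (V t), forall x, continuous (fun t => V t x)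
      & forall t x, 0 <= t -> U t x = V t x].
Proof.
move=> [U_lin _ _ Uc].
have /choice[V VU] (t : R) : exists A : {linear H -> H},
    continuous A /\ forall x, A x = U (Num.max 0 t) x.
  have [|lin [M UM]] := U_lin (Num.max 0 t); first by rewrite le_max lexx.
  exists (linear_pack lin); split=> //.
  apply: (@linear_bound_continuous _ _ _ _ (rnorm M)) => x /=.
  have Mx0 := le_trans (normr_ge0 _) (UM x).
  have := UM x; rewrite -(ger0_norm Mx0) normrM normr_id !normE.
  by rewrite -rmorphM ler_ofR.
exists V; split=> [t|x|t x t0]; first by have [] := VU t.
  have -> : (fun t => V t x) = fun t => U (Num.max 0 t) x.
    by apply/funext => t; have [_ ->] := VU t.
  exact: continuous_comp_max0 (Uc x).
by have [_ ->] := VU t; rewrite max_r.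
Qed.

End Extension.

Theorem theorem3 (R : realType) (H : completeNormedModType R[i])
    (ip : H -> H -> R[i]) (hip : is_inner_product ip)
    (U : R -> H -> H) (hU : C0_semigroup U)
    (z Ldz : H) (hz0 : z != 0) (hLdz : is_gen_adjoint ip U z Ldz)
    (f : H -> R -> Cplx R)
    (hf_cont : forall x : H, {within `[0, +oo[, continuous (f x)})
    (hf_eq : forall (x : H) (t : R), 0 <= t ->
       f x t = ip (U t (projQ ip z x)) (projQ ip z Ldz) / ip z z
               - bochner0t (fun s : R =>
                   f x (t - s) * (ip (U s z) (projQ ip z Ldz) / ip z z)) t) :
  C0_semigroup (fun (t : R) (x : H) =>
    projP ip z x + U t (projQ ip z x)
    - bochner0t (fun s : R => f x (t - s) *: U s z) t).
Proof.
have [_ U0 UD _] := hU; have [V [cV cVx UV]] := C0_semigroup_extension hU.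
pose F x (t : R) : Cplx R := f x (Num.max 0 t).
have cF x : continuous (F x) := continuous_comp_max0 (hf_cont x).
have Ff x t : 0 <= t -> F x t = f x t by move=> t0; rewrite /F max_r.
have V0 x : V 0 x = x by rewrite -UV // U0.
have VD (s t : R) x : 0 <= s -> 0 <= t -> V (s + t) x = V s (V t x).
  by move=> s0 t0; rewrite -!UV ?addr_ge0 // UD.
have F_eq x t : 0 <= t ->
    F x t = memory_functional ip z Ldz (V t (projQ ip z x)) -
      conv0t (F x) (fun s => memory_functional ip z Ldz (V s z)) t.
  move=> t0; rewrite Ff // -UV //.
  have <- : conv0t (f x) (fun s => memory_functional ip z Ldz (U s z)) t =
      conv0t (F x) (fun s => memory_functional ip z Ldz (V s z)) t.
    by apply: eq_conv0t => // s /andP[s0 _]; rewrite ?Ff ?UV.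
  exact: hf_eq.
apply: (@eq_C0_semigroup _ _ (projected_dynamics ip V z F)) => [t x t0|].
  rewrite /projected_dynamics UV //; congr (_ - _).
  by apply: (eq_conv0t (psi := f x) (w := U^~ z)) => // s /andP[s0 _];
    rewrite ?Ff ?UV.
exact: (projected_dynamics_C0_semigroup cV cVx V0 VD hip hz0
  (eq_is_gen_adjoint UV hLdz) cF F_eq).
Qed.
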